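(* Let $\Omega$ be an open subset of $\mathbb{R}^d$, $\sigma>0$, and let $0\le\gamma\le\theta\le\pi/2$ with $\gamma\ne\pi/2$. Suppose that $\omega>0$ and that $\phi\in H^1_0(\Omega)$ is a solution of $$i\omega\phi=e^{i\theta}\Delta\phi+e^{i\gamma}|\phi|^\sigma\phi\quad\text{in }\Omega .$$ Then $\phi\equiv0$. The same conclusion is valid if $\omega=0$ and $\theta\ne\gamma$.
   Context: Functions are complex-valued. Solution is understood in the weak sense: $\phi\in H^1_0(\Omega)\cap L^{\sigma+2}(\Omega)$ and $i\omega\int_\Omega\phi\overline{v}=-e^{i\theta}\int_\Omega\nabla\phi\cdot\nabla\overline{v}+e^{i\gamma}\int_\Omega|\phi|^\sigma\phi\,\overline{v}$ for all $v\in H^1_0(\Omega)\cap L^{\sigma+2}(\Omega)$. *)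

(* Defs.v *)
From HB Require Import structures.
From mathcomp Require Import all_boot all_order all_algebra.
From mathcomp Require Import all_classical all_reals all_analysis.
From mathcomp Require Import complex.

Set Implicit Arguments.
Unset Strict Implicit.
Unset Printing Implicit Defensive.

Import Order.TTheory GRing.Theory Num.Theory.
Import numFieldNormedType.Exports.

Local Open Scope classical_set_scope.
Local Open Scope complex_scope.
Local Open Scope ring_scope.

(* The sigma-algebra on R^d is the one generated by the coordinates, i.e. the
   d-fold product of the Borel sigma-algebra of R, which is the Borel one. *)
Definition rV_display : measure_display.
Proof. exact: default_measure_display. Qed.

Section rV_measurable.
Context {R : realType} {d : nat}.

Definition rV_coord (i : 'I_d) (x : 'rV[R]_d) : R := x ord0 i.

Let rV_set0 : g_sigma_preimage rV_coord set0.
Proof. exact: sigma_algebra0. Qed.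

Let rV_setC A : g_sigma_preimage rV_coord A ->
  g_sigma_preimage rV_coord (~` A).
Proof. exact: sigma_algebraC. Qed.

Let rV_bigcup (F : (set 'rV[R]_d)^nat) :
  (forall i, g_sigma_preimage rV_coord (F i)) ->
  g_sigma_preimage rV_coord (\bigcup_i F i).
Proof. exact: sigma_algebra_bigcup. Qed.

HB.instance Definition _ := @isMeasurable.Build rV_display
  'rV[R]_d (g_sigma_preimage rV_coord) rV_set0 rV_setC rV_bigcup.

End rV_measurable.

Lemma measurable_rV_coord (R : realType) (d : nat) (i : 'I_d) :
  measurable_fun [set: 'rV[R]_d] (fun x => x ord0 i).
Proof.
move=> _ Y mY; rewrite setTI; apply: sub_sigma_algebra => /=.
rewrite -bigcup_seq/=; exists i => /=; first by rewrite mem_index_enum.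
by exists Y => //; rewrite setTI.
Qed.

Lemma measurable_fun_rV (R : realType) (d : nat) disp
    (T : measurableType disp) (f : T -> 'rV[R]_d) :
  (forall i, measurable_fun [set: T] (fun t => f t ord0 i)) ->
  measurable_fun [set: T] f.
Proof.
move=> mf; have sub : g_sigma_preimage (fun i => rV_coord i \o f) `<=` measurable.
  apply: smallest_sub; first exact: sigma_algebra_measurable.
  rewrite -bigcup_seq; apply: bigcup_sub => i _ _ [B mB <-].
  exact: mf.
by rewrite g_sigma_preimage_comp in sub => _ A mA; apply: sub; exists A.
Qed.

Section lebesgue_measure_rV.
Context {R : realType}.

Definition rV_cons (d : nat) (p : 'rV[R]_d * R) : 'rV[R]_d.+1 :=
  \row_i oapp (p.1 ord0) p.2 (unlift ord0 i).

Lemma measurable_rV_cons d : measurable_fun [set: 'rV[R]_d * R] (@rV_cons d).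
Proof.
apply: measurable_fun_rV => i; under eq_fun do rewrite mxE.
case: (unliftP ord0 i) => [j|] _ /=; last exact: measurable_snd.
exact: measurableT_comp (measurable_rV_coord j) measurable_fst.
Qed.

Definition lebesgue_rV_step d (m : {measure set 'rV[R]_d -> \bar R}) :=
  pushforward (m \x lebesgue_measure)%E (@rV_cons d).

Section lebesgue_rV_step_measure.
Variables (d : nat) (m : {measure set 'rV[R]_d -> \bar R}).

Let step0 : lebesgue_rV_step m set0 = 0%E.
Proof. by rewrite /lebesgue_rV_step /pushforward preimage_set0 measure0. Qed.

Let step_ge0 A : (0 <= lebesgue_rV_step m A)%E.
Proof. by apply: measure_ge0; exact: measurable_rV_cons. Qed.

Let step_sigma_additive : semi_sigma_additive (lebesgue_rV_step m).
Proof.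
by apply: measure_semi_sigma_additive; exact: measurable_rV_cons.
Qed.

HB.instance Definition _ := isMeasure.Build _ _ _ (lebesgue_rV_step m)
  step0 step_ge0 step_sigma_additive.

End lebesgue_rV_step_measure.

(* Lebesgue measure on R^d, by iterated products with lebesgue_measure on R;
   lebesgue_rV_box below gives its value on boxes. *)
Fixpoint lebesgue_rV (d : nat) : {measure set 'rV[R]_d -> \bar R} :=
  match d with
  | 0%N => \d_(0 : 'rV[R]_0)
  | d'.+1 => lebesgue_rV_step (lebesgue_rV d')
  end.

Lemma lebesgue_rV_box d (a b : 'rV[R]_d) : (forall i, a ord0 i <= b ord0 i) ->
  lebesgue_rV d [set x : 'rV[R]_d | forall i, x ord0 i \in `[a ord0 i, b ord0 i]] =
  (\prod_(i < d) (b ord0 i - a ord0 i))%:E.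
Proof.
elim: d a b => [|d IH] a b ab.
  by rewrite big_ord0 /= diracE mem_set// => -[].
pose box n (a b : 'rV[R]_n) := [set x : 'rV_n | forall i, x ord0 i \in `[a ord0 i, b ord0 i]].
have mbox n (u v : 'rV[R]_n) : measurable (box n u v).
  rewrite (_ : box n u v = \bigcap_i ((fun x => x ord0 i) @^-1` `[u ord0 i, v ord0 i])).
    apply: fin_bigcap_measurable => // i _.
    by rewrite -[X in measurable X]setTI; exact: measurable_rV_coord.
  by apply/seteqP; split=> [x xb i _|x xb i]; [exact: xb|exact: (xb i I)].
pose tl (u : 'rV[R]_d.+1) := \row_i u ord0 (lift ord0 i).
rewrite /= /lebesgue_rV_step /pushforward.
rewrite (_ : _ @^-1` _ = box d (tl a) (tl b) `*` `[a ord0 ord0, b ord0 ord0]); last first.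
  apply/seteqP; split=> [[x t]/= xt|[x t]/= [xb tb] i].
    split=> [i|]; last by have := xt ord0; rewrite mxE unlift_none.
    by have := xt (lift ord0 i); rewrite !mxE liftK.
  rewrite mxE; case: (unliftP ord0 i) => [j|] -> //=.
  by have := xb j; rewrite !mxE.
rewrite product_measure1E//; last exact: mbox.
have -> := IH (tl a) (tl b); last by move=> i; rewrite !mxE.
rewrite /= lebesgue_measure_itv/= lte_fin big_ord_recl mulrC EFinM.
under eq_bigr do rewrite !mxE.
congr (_ * _)%E; case: ltgtP (ab ord0) => // ->; by rewrite subrr.
Qed.

End lebesgue_measure_rV.

Section sobolev.
Context {R : realType} {d : nat}.
Implicit Types (Omega : set 'rV[R]_d) (u v phi eta : 'rV[R]_d -> R[i]).
Local Notation mu := (@lebesgue_rV R d).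

Definition partial (i : 'I_d) (f : 'rV[R]_d -> R) : 'rV[R]_d -> R :=
  'D_(delta_mx ord0 i) f.

Fixpoint Ck (k : nat) (f : 'rV[R]_d -> R) : Prop :=
  match k with
  | 0%N => continuous f
  | k'.+1 => continuous f /\ forall i : 'I_d,
      (forall x, derivable f x (delta_mx ord0 i)) /\ Ck k' (partial i f)
  end.

Definition smooth (f : 'rV[R]_d -> R) : Prop := forall k, Ck k f.

Definition test_function Omega eta : Prop :=
  [/\ smooth (fun x => complex.Re (eta x)),
      smooth (fun x => complex.Im (eta x)),
      compact (closure [set x | eta x != 0]) &
      closure [set x | eta x != 0] `<=` Omega].

Definition cpartial (i : 'I_d) eta : 'rV[R]_d -> R[i] := fun x =>
  partial i (fun y => complex.Re (eta y)) x +i*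
  partial i (fun y => complex.Im (eta y)) x.

(* Only meaningful when the real and imaginary parts of u are integrable. *)
Definition cintegral Omega u : R[i] :=
  (\int[mu]_(x in Omega) complex.Re (u x)) +i*
  (\int[mu]_(x in Omega) complex.Im (u x)).

(* Normc.normc is the R-valued modulus of a complex number. *)
Definition Lp Omega (p : R) u : Prop :=
  [/\ measurable_fun Omega (fun x => complex.Re (u x)),
      measurable_fun Omega (fun x => complex.Im (u x)) &
      mu.-integrable Omega (fun x => (Normc.normc (u x) `^ p)%:E)].

Definition is_weak_gradient Omega u (g : 'I_d -> 'rV[R]_d -> R[i]) : Prop :=
  (forall i, Lp Omega 2 (g i)) /\
  forall i eta, test_function Omega eta ->
    cintegral Omega (fun x => u x * cpartial i eta x) =
    - cintegral Omega (fun x => g i x * eta x).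

Definition sobolev_H1 Omega u : Prop :=
  Lp Omega 2 u /\ exists g, is_weak_gradient Omega u g.

(* A representative of the weak gradient, which is unique up to a null set
   when u is in H^1; junk value 0 when there is none. *)
Definition wgrad Omega u : 'I_d -> 'rV[R]_d -> R[i] :=
  xget (fun _ _ => 0) [set g | is_weak_gradient Omega u g].

Definition H1norm Omega u : \bar R :=
  ((\int[mu]_(x in Omega) (Normc.normc (u x) ^+ 2)%:E +
    \sum_(i < d) \int[mu]_(x in Omega)
      (Normc.normc (wgrad Omega u i x) ^+ 2)%:E) `^ 2^-1)%E.

(* The closure of the test functions in H^1. *)
Definition sobolev_H10 Omega u : Prop :=
  sobolev_H1 Omega u /\
  forall e : R, 0 < e -> exists eta, test_function Omega eta /\
    (H1norm Omega (fun x => (u x - eta x)%R) < e%:E)%E.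

Definition expi (t : R) : R[i] := cos t +i* sin t.

(* i omega phi = e^(i theta) Delta phi + e^(i gamma) |phi|^sigma phi in Omega,
   tested against the v in H^1_0 and L^(sigma + 2). *)
Definition weak_solution Omega (sigma gamma theta omega : R) phi : Prop :=
  [/\ sobolev_H10 Omega phi, Lp Omega (sigma + 2) phi &
    forall v, sobolev_H10 Omega v -> Lp Omega (sigma + 2) v ->
      'i%C * omega%:C * cintegral Omega (fun x => phi x * (v x)^*%C) =
      - expi theta * cintegral Omega
          (fun x => \sum_(i < d) wgrad Omega phi i x * (wgrad Omega v i x)^*%C)
      + expi gamma * cintegral Omega
          (fun x => (Normc.normc (phi x) `^ sigma)%:C * phi x * (v x)^*%C)].

End sobolev.

(* Main.v *)
(** Testing the equation with [phi] itself and multiplying by [e^(-i gamma)],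
the imaginary part reads
[omega cos(gamma) |phi|_2^2 + sin(theta - gamma) |grad phi|_2^2 = 0], a sum of
two nonnegative terms.  If [omega > 0], the first one forces [phi = 0].  If
[omega = 0] and [theta <> gamma], the second one forces [grad phi = 0], and the
real part of the equation then gives [|phi|_(sigma + 2) = 0]. *)
Require Import Defs.
From mathcomp Require Import all_boot all_order all_algebra.
From mathcomp Require Import all_classical all_reals all_analysis.
From mathcomp Require Import complex.
From mathcomp Require Import lra ring.
Import Order.TTheory GRing.Theory Num.Theory.
Import numFieldNormedType.Exports.
Local Open Scope classical_set_scope.
Local Open Scope complex_scope.
Local Open Scope ring_scope.

(** The sigma-algebra is generated by the coordinates, not by the topology. The link is that an open
    set is the union of the rational boxes it contains, and these are countably many. *)
Lemma open_measurable_rV (R : realType) (d : nat) (U : set 'rV[R]_d) :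
  open U -> measurable U.
Proof.
move=> oU.
pose box (p : 'rV[rat]_d * 'rV[rat]_d) := [set x : 'rV[R]_d |
  forall i, x ord0 i \in `]ratr (p.1 ord0 i), ratr (p.2 ord0 i)[].
(* Boxes not inside [U] are replaced by [set0], so that the union runs over a whole countable
   type. *)
have -> : U = \bigcup_p (if `[< box p `<=` U >] then box p else set0).
  apply/seteqP; split=> [x Ux|x [p _]]; last by case: asboolP => // pU; exact: pU.
  have [e /= e0 xeU] : exists2 e : R, 0 < e & ball x e `<=` U.
    by move: oU; rewrite openE => /(_ _ Ux)/nbhs_ballP.
  have /choice[a xa] i : exists q : rat, ratr q \in `]x ord0 i - e, x ord0 i[.
    by apply: rat_in_itvoo; rewrite ltrBlDr ltrDl.
  have /choice[b xb] i : exists q : rat, ratr q \in `]x ord0 i, x ord0 i + e[.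
    by apply: rat_in_itvoo; rewrite ltrDl.
  exists (\row_i a i, \row_i b i) => //; case: asboolP => [_ i|[]].
    by rewrite !mxE in_itv/= (itvP (xa i)) (itvP (xb i)).
  move=> y yab; apply: xeU; split=> // i j; rewrite (ord1 i).
  move: (xa j) (xb j) (yab j); rewrite !mxE !in_itv/= => /andP[? ?] /andP[? ?] /andP[? ?].
  by rewrite /ball/= ltr_norml; lra.
apply: countable_bigcupT_measurable => [|p]; first exact: countableP.
case: asboolP => // _.
rewrite (_ : box p = \bigcap_i
  ((fun x => x ord0 i) @^-1` `]ratr (p.1 ord0 i), ratr (p.2 ord0 i)[)).
  apply: fin_bigcap_measurable => // i _.
  by rewrite -[X in measurable X]setTI; exact: measurable_rV_coord.
by apply/seteqP; split=> [x xb i _|x xb i]; [exact: xb|exact: (xb i I)].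
Qed.

Section weak_solutions.
Context {R : realType} {d : nat}.
Implicit Types (Omega : set 'rV[R]_d) (u : 'rV[R]_d -> R[i]).
Local Notation mu := (@lebesgue_rV R d).

Lemma mul_conjc (z : R[i]) : z * z^*%C = (Normc.normc z ^+ 2)%:C.
Proof.
case: z => a b /=; rewrite sqr_sqrtr ?addr_ge0 ?sqr_ge0//.
by apply/eqP; rewrite eq_complex /=; apply/andP; split; apply/eqP; ring.
Qed.

Lemma normc_ge0 (z : R[i]) : 0 <= Normc.normc z.
Proof. by case: z => a b; exact: sqrtr_ge0. Qed.

(** Once the equation is tested with [phi] itself, all three integrands are real; this separates the
    phases from real integrals. *)
Lemma cintegral_real Omega u (f : 'rV[R]_d -> R) : (forall x, u x = (f x)%:C) ->
  cintegral Omega u = (\int[mu]_(x in Omega) f x)%:C.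
Proof.
move=> uf; have -> : u = fun x => (f x)%:C by exact/funext.
by rewrite /cintegral /= [in X in _ +i* X]/Rintegral integral0.
Qed.

Lemma Lp_integral_eq0 Omega (p : R) u : measurable Omega -> p != 0 ->
  Lp Omega p u -> \int[mu]_(x in Omega) Normc.normc (u x) `^ p = 0 ->
  \forall x \ae mu, Omega x -> u x = 0.
Proof.
move=> mO p0 [_ _ iu] u0.
have /(ae_eq_integral_abs mu mO (measurable_int mu iu)) :
    (\int[mu]_(x in Omega) `|(Normc.normc (u x) `^ p)%:E| = 0)%E.
  under eq_integral do rewrite gee0_abs ?lee_fin ?powR_ge0//.
  (* The hypothesis is about a real-valued integral, which would also be 0 if the extended one were
     infinite; integrability excludes that. *)
  by rewrite -[LHS]fineK ?integrable_fin_num//; congr EFin.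
apply: filterS => x /[apply] -[] /powR_eq0_eq0.
exact: Normc.eq0_normc.
Qed.

(** [G] is the squared L^2 norm of the weak gradient. The first identity is the real part of the
    tested equation; the second is [cos gamma] times the imaginary part, with [B] eliminated by the
    first. *)
Lemma weak_solution_energy {Omega} {sigma gamma theta omega : R} {phi} :
  0 < sigma ->
  weak_solution Omega sigma gamma theta omega phi ->
  exists2 G : R, 0 <= G &
  let A := \int[mu]_(x in Omega) Normc.normc (phi x) `^ 2 in
  let B := \int[mu]_(x in Omega) Normc.normc (phi x) `^ (sigma + 2) in
  cos theta * G = cos gamma * B /\
  omega * cos gamma * A + sin (theta - gamma) * G = 0.
Proof.
move=> sigma0 [phi1 phip /(_ phi phi1 phip)].
pose g x := \sum_(i < d) Normc.normc (wgrad Omega phi i x) ^+ 2.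
rewrite (cintegral_real _ _ (fun x => Normc.normc (phi x) `^ 2)); last first.
  by move=> x; rewrite mul_conjc powR_mulrn ?normc_ge0.
rewrite (cintegral_real _ _ g); last first.
  by move=> x; rewrite raddf_sum; apply: eq_bigr => i _; rewrite mul_conjc.
rewrite (cintegral_real _ _ (fun x => Normc.normc (phi x) `^ (sigma + 2))); last first.
  move=> x; rewrite -mulrA mul_conjc -powR_mulrn ?normc_ge0// -rmorphM/=.
  (* Exponents add where [phi x] is nonzero; elsewhere both sides are 0, since [sigma] and
     [sigma + 2] are positive. *)
  have [->|phi0] := eqVneq (Normc.normc (phi x)) 0; last by rewrite powRD// phi0 implybT.
  by rewrite !powR0 ?mulr0// gt_eqF// addr_gt0.
set G := (\int[mu]_(x in Omega) g x).
move=> /eqP; rewrite eq_complex/= => /andP[/eqP eRe /eqP eIm].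
exists G; first by apply: Rintegral_ge0 => x _; apply: sumr_ge0 => i _; exact: sqr_ge0.
have eRe' : cos theta * G = cos gamma *
    \int[mu]_(x in Omega) Normc.normc (phi x) `^ (sigma + 2) by lra.
(* Replacing [cos theta * G] by [cos gamma * B] makes [cos gamma] a common factor, and the imaginary
   part remains. *)
split=> //; rewrite sinB mulrBl mulrAC [cos theta * _ * _]mulrAC eRe'.
move: eIm; set A := Rintegral _ _ _; set B := Rintegral _ _ _ => eIm.
have -> : omega * A = - sin theta * G + sin gamma * B by lra.
ring.
Qed.

End weak_solutions.

Theorem proposition1p6 (R : realType) (d : nat) (Omega : set 'rV[R]_d)
    (Omega_open : open Omega) (sigma gamma theta : R) (sigma_gt0 : 0 < sigma)
    (gamma_ge0 : 0 <= gamma) (gamma_le_theta : gamma <= theta)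
    (theta_le_pihalf : theta <= pi / 2) (gamma_neq_pihalf : gamma <> pi / 2) :
  (forall (omega : R) (phi : 'rV[R]_d -> R[i]), 0 < omega ->
     weak_solution Omega sigma gamma theta omega phi ->
     \forall x \ae lebesgue_rV d, Omega x -> phi x = 0) /\
  (theta <> gamma -> forall phi : 'rV[R]_d -> R[i],
     weak_solution Omega sigma gamma theta 0 phi ->
     \forall x \ae lebesgue_rV d, Omega x -> phi x = 0).
Proof.
have mO : measurable Omega by exact: open_measurable_rV.
have pi0 := pi_gt0 R.
have cosg : 0 < cos gamma.
  apply: cos_gt0_pihalf; rewrite [_ < pi / 2]lt_neqAle (introN eqP gamma_neq_pihalf)/=; lra.
split=> [omega phi omega0 phiW|theta_neq phi phiW].
- have [G G0 /= [_ energy]] := weak_solution_energy sigma_gt0 phiW.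
  have [[[phi2 _] _] _ _] := phiW.
  apply: Lp_integral_eq0 phi2 _ => //.
  have sinD0 : 0 <= sin (theta - gamma) by apply: sin_ge0_pi; lra.
  (* Only the upper bound by 0 is left: [omega * cos gamma] is positive, and its product with the
     integral is [- sin (theta - gamma) * G], hence nonpositive. *)
  apply/eqP; rewrite eq_le Rintegral_ge0 ?andbT => [|x _]; last exact: powR_ge0.
  by rewrite -(pmulr_rle0 _ (mulr_gt0 omega0 cosg)) -oppr_ge0 (addr0_eq energy) mulr_ge0.
- have [G G0 /= [eRe energy]] := weak_solution_energy sigma_gt0 phiW.
  have [_ phip _] := phiW.
  (* With [omega = 0] the L^2 term drops out of the energy identity, so vanishing is read off the
     integral with exponent [sigma + 2], tied to [G] by the real part. *)
  apply: Lp_integral_eq0 phip _ => //; first by rewrite gt_eqF// addr_gt0.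
  have sinD0 : 0 < sin (theta - gamma).
    have : gamma < theta by rewrite lt_neqAle gamma_le_theta andbT eq_sym; exact/eqP.
    move=> ?; apply: sin_gt0_pi; lra.
  move: energy => /eqP; rewrite !mul0r add0r mulf_eq0 gt_eqF//= => /eqP G00.
  move: eRe; rewrite G00 mulr0 => /esym/eqP.
  by rewrite mulf_eq0 gt_eqF//= => /eqP.
Qed.
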